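(* Let $K$ be a field, let $m,n\ge 1$ be integers, and let $f(X,Y)=a_0+a_1Y+\cdots+a_mY^m$ and $g(X,Y)=b_0+b_1Y+\cdots+b_nY^n$, with $a_0,a_1,\ldots,a_m,b_0,b_1,\ldots,b_n\in K[X]$, $a_0a_mb_n\neq 0$, and $f$ irreducible over $K(X)$. If $a_m=pq$ with $p,q\in K[X]$, $p$ irreducible over $K$, and $$\deg p>(n-1)\deg q+mn\deg b_n+H_1(f),$$ then the polynomial $f(X,g(X,Y))$ is irreducible over $K(X)$.
   Context: For $f=a_0(X)+a_1(X)Y+\cdots+a_m(X)Y^m\in K[X,Y]$ with $a_m\ne 0$, $H_1(f)=\max\{\deg a_0,\ldots,\deg a_{m-1}\}$, where $\deg$ is the degree in $X$ (zero coefficients are ignored in the maximum, i.e. $\deg 0=-\infty$). ''Irreducible over $K(X)$'' means irreducible in the ring $K(X)[Y]$. *)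

(* Defs.v *)
From mathcomp Require Import all_boot all_order all_algebra.

Set Implicit Arguments.
Unset Strict Implicit.
Unset Printing Implicit Defensive.

Import GRing.Theory.
Local Open Scope ring_scope.

(* A polynomial in K[X, Y] is an element of {poly {poly K}}:
   the outer variable is Y, the inner one is X. *)

(* Degree of a nonzero polynomial; the value at 0 is a dummy 0. *)
Definition pdeg (R : nzRingType) (p : {poly R}) : nat := (size p).-1.

(* Zero coefficients are skipped. The maximum over an empty family is 0 here
   instead of -oo; this only concerns f = a_m Y^m, excluded when a_0 != 0 and
   f has positive degree in Y. *)
Definition H1 (K : fieldType) (f : {poly {poly K}}) : nat :=
  (\max_(i < pdeg f | (f`_i != 0)%R) pdeg (f`_i)%R)%N.

Definition over_fracX (K : fieldType) (f : {poly {poly K}}) :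
    {poly {fraction {poly K}}} :=
  map_poly (@tofrac {poly K}) f.

Definition irreducible_over_KX (K : fieldType) (f : {poly {poly K}}) : Prop :=
  irreducible_poly (over_fracX f).

(* Main.v *)
Require Import Defs.
From mathcomp Require Import all_boot all_order all_algebra.

Import GRing.Theory.
Local Open Scope ring_scope.

(** Write R = K[X].  The degree condition makes p coprime to a_0 and b_n and,
    when n > 1, to q; so p divides the leading coefficient a_m b_n^m of
    f(X, g) exactly once.

    The heart of the proof is that p divides the leading coefficient t of
    every nonconstant divisor F of f(X, g) in R[Y].  Let theta be a root of F.
    Since t theta is integral over R, so is t^N g(theta) for some N: it is a
    root of a monic polynomial of R[Z] of degree deg F, the characteristic
    polynomial of multiplication by t^N g modulo F
    ([char_poly_annihilates_mod]).  So g(theta) is a root of some h in R[Z]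
    with leading coefficient a power of t.  But g(theta) is also a root of the
    irreducible f, hence f divides h over K(X)
    ([irreducible_dvd_annihilator]).  As p does not divide a_0, Gauss's lemma
    at p gives c h = f w over R with c prime to p, and comparing leading
    coefficients, p divides c t^e, hence t.

    If now f(X, g) = F G over K(X) with both factors nonconstant, Gauss's
    lemma clears denominators up to a scalar c prime to p, and p divides the
    leading coefficients of both factors: p^2 divides c a_m b_n^m, which is
    impossible for n > 1.  When n = 1 the prime p may also divide q, but then
    the inequality deg f <= deg h = deg F, valid for every nonconstant
    divisor F, already rules out proper factors ([irreducible_comp_linear]). *)

(** * Passing between R[Y] and Frac(R)[Y] *)

Lemma size_map_tofrac (R : idomainType) (F : {poly R}) :
  size (map_poly (@tofrac R) F) = size F.
Proof.
by apply: size_map_inj_poly; rewrite ?rmorph0 // => x y /eqP;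
  rewrite tofrac_eq => /eqP.
Qed.

Lemma fraction_clear_denominator (R : idomainType) (z : {fraction R}) :
  exists2 d : R, d != 0 & exists x : R, tofrac d * z = tofrac x.
Proof.
elim/quotW: z => r; exists (frac r).2; first exact: denom_ratioP.
exists (frac r).1; apply/eqP; unlock tofrac.
rewrite -[_ * _](FracField.pi_mul (Ratio (frac r).2 1) r).
rewrite FracField.equivf_def /FracField.mulf.
rewrite !numden_Ratio ?mulf_neq0 ?oner_eq0 ?denom_ratioP //.
by rewrite mulr1 mul1r mulrC.
Qed.

Lemma scale_mulXDC (L : comNzRingType) (Q : {poly L}) (z d e : L) :
  (d * e) *: (Q * 'X + z%:P) = e *: (d *: Q) * 'X + (d * (e * z))%:P.
Proof.
rewrite scalerDr scalerAl scalerA [e * d]mulrC.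
by rewrite -[_ *: z%:P]mul_polyC -polyCM mulrA.
Qed.

Lemma poly_clear_denominators (R : idomainType) (Q : {poly {fraction R}}) :
  exists2 d : R, d != 0 &
    exists P : {poly R}, tofrac d *: Q = map_poly (@tofrac R) P.
Proof.
elim/poly_ind: Q => [|Q z [d d_neq0 [P DP]]].
  by exists 1; rewrite ?oner_eq0 //; exists 0; rewrite scaler0 rmorph0.
have [e e_neq0 [x Dx]] := fraction_clear_denominator R z.
exists (d * e); first by rewrite mulf_neq0.
exists (e *: P * 'X + (d * x)%:P).
rewrite [RHS]rmorphD [X in _ = X + _]rmorphM /= map_polyX map_polyC /=.
by rewrite map_polyZ /= -DP !tofracM -Dx scale_mulXDC.
Qed.

(** Over a domain, [%|] is pseudo-divisibility: a nonzero scalar is allowed in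
    front of the dividend.  Clearing denominators in a quotient over the
    fraction field produces exactly such a scalar. *)
Lemma dvdp_tofrac (R : idomainType) (F G : {poly R}) :
  (map_poly (@tofrac R) F %| map_poly (@tofrac R) G) = (F %| G).
Proof.
have inj_tofrac : injective (map_poly (@tofrac R)).
  apply: map_inj_poly; rewrite ?rmorph0 // => x y /eqP.
  by rewrite tofrac_eq => /eqP.
apply/dvdpP/Pdiv.Idomain.dvdpP => [[Q DQ]|[[d Q] /= d_neq0 DQ]].
  have [d d_neq0 [P DP]] := poly_clear_denominators R Q.
  exists (d, P) => //=; apply: inj_tofrac.
  by rewrite map_polyZ /= DQ rmorphM /= -DP -scalerAl.
exists ((tofrac d)^-1 *: map_poly (@tofrac R) Q).
by rewrite -scalerAl -rmorphM /= -DQ map_polyZ /= scalerK ?tofrac_eq0.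
Qed.

(** Allows the rest of the proof to work in R[Y], where leading coefficients
    can be tested for divisibility by p. *)
Lemma irreducible_tofrac (R : idomainType) (F : {poly R}) :
  irreducible_poly (map_poly (@tofrac R) F) <-> irreducible_poly F.
Proof.
rewrite /irreducible_poly size_map_tofrac; split=> -[F_gt1 F_irr]; split=> // Q.
  by move=> Q1 QF; rewrite /eqp -!(dvdp_tofrac R); apply: F_irr;
    rewrite ?size_map_tofrac ?dvdp_tofrac.
have [d d_neq0 [P DP]] := poly_clear_denominators R Q.
have nz : tofrac d != 0 by rewrite tofrac_eq0.
rewrite -(size_scale Q nz) -(dvdpZl _ _ nz) -(eqp_ltrans (eqp_scale Q nz)).
by rewrite DP size_map_tofrac /eqp !dvdp_tofrac => P1 PF; apply: F_irr.
Qed.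

(** * Factors of a composition *)

(** Cayley-Hamilton for multiplication by t^N g modulo F, with t = lead_coef F.
    Pseudo-division of Y^i g by F, scaled to a common power t^N, gives a matrix
    M over R with (t^N g - M) v = 0 mod F for v = (1, Y, Y^2, ...).
    Multiplying by the adjugate shows that det (t^N g - M), which is the
    characteristic polynomial of M evaluated at t^N g, annihilates v mod F, in
    particular its first entry 1. *)
Lemma char_poly_annihilates_mod (R : idomainType) (F g : {poly R}) :
  (1 < size F)%N ->
  exists N (h : {poly R}),
    [/\ h \is monic, size h = size F & F %| h \Po (lead_coef F ^+ N *: g)].
Proof.
move=> F_gt1; have F_neq0 : F != 0 by rewrite -size_poly_gt0 ltnW.
case Dr: (size F) F_gt1 => [//|[//|r]] _; pose t := lead_coef F.
pose k (i : 'I_r.+1) := scalp ('X^i * g) F; pose N := (\sum_i k i)%N.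
have kN i : (k i <= N)%N by rewrite /N (bigD1 i) //= leq_addr.
pose M : 'M_r.+1 := \matrix_(i, j) (t ^+ (N - k i) *: (('X^i * g) %% F))`_j.
exists N, (char_poly M); split; rewrite ?char_poly_monic ?size_char_poly //.
pose B := (t ^+ N *: g)%:M - map_mx (@polyC R) M.
have -> : char_poly M \Po (t ^+ N *: g) = \det B.
  rewrite /char_poly -[LHS]/(comp_poly (t ^+ N *: g) (\det _)) -det_map_mx.
  congr (\det _); apply/matrixP => i j; rewrite !mxE rmorphB /= comp_polyC.
  by rewrite rmorphMn /= comp_polyX.
pose v := \col_(i < r.+1) 'X^i : 'cV[{poly R}]_r.+1.
pose s := \col_(i < r.+1) (t ^+ (N - k i) *: (('X^i * g) %/ F)).
have Bv : B *m v = F *: s.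
  apply/colP => i; rewrite mulmxBl mul_scalar_mx !mxE.
  set rem := t ^+ (N - k i) *: (('X^i * g) %% F).
  have -> : \sum_j map_mx (@polyC R) M i j * v j 0 = rem.
    have rem_le : (size rem <= r.+1)%N.
      rewrite (leq_trans (size_scale_leq _ _)) // -ltnS -Dr.
      by rewrite ltn_modp.
    (* Row i of M lists the coefficients of rem, which has degree at most r. *)
    apply/polyP => j; rewrite coef_sum.
    transitivity (\sum_(l < r.+1) rem`_l * (j == l)%:R).
      by apply: eq_bigr => l _; rewrite !mxE mul_polyC coefZ coefXn.
    have [j_lt|j_ge] := ltnP j r.+1.
      rewrite (bigD1 (Ordinal j_lt)) //= eqxx mulr1 big1 ?addr0 // => l.
      by rewrite -val_eqE eq_sym /= => /negPf->; rewrite mulr0.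
    rewrite big1 ?(nth_default _ (leq_trans rem_le j_ge)) // => l _.
    by rewrite gtn_eqF ?mulr0 // (leq_trans (ltn_ord l)).
  apply/eqP; rewrite subr_eq mulrC; apply/eqP.
  rewrite -scalerAr -{1}(subnK (kN i)) exprD -scalerA.
  by rewrite Pdiv.Idomain.divp_eq scalerDr scalerAl mulrC.
have: (\adj B *m B *m v) 0 0 = (F *: (\adj B *m s)) 0 0.
  by rewrite -mulmxA Bv scalemxAr.
by rewrite mul_adj_mx mul_scalar_mx !mxE expr0 mulr1 => ->; apply: dvdp_mulIl.
Qed.

(** The polynomial h comes from the characteristic polynomial above by the
    substitution Z -> t^N Z, so F divides both f(g) and h(g).  Were f and h
    coprime, a Bezout relation evaluated at g would make F constant. *)
Lemma irreducible_dvd_annihilator (R : idomainType) (f g F : {poly R}) :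
  irreducible_poly f -> F %| f \Po g -> (1 < size F)%N ->
  exists e (h : {poly R}),
    [/\ size h = size F, lead_coef h = lead_coef F ^+ e & f %| h].
Proof.
move=> f_irr Ffg F_gt1; have F_neq0 : F != 0 by rewrite -size_poly_gt0 ltnW.
have [N [h [h_monic h_size Fh]]] := char_poly_annihilates_mod R F g F_gt1.
set t := lead_coef F in Fh; pose l := t ^+ N *: 'X.
have tN_neq0 : t ^+ N != 0 by rewrite expf_neq0 ?lead_coef_eq0.
have l_size : size l = 2 by rewrite size_scale ?size_polyX.
exists (N * (size h).-1)%N, (h \Po l); split.
- by rewrite size_comp_poly2.
- rewrite lead_coef_comp ?l_size // (monicP h_monic) mul1r.
  by rewrite lead_coefZ lead_coefX mulr1 exprM.
have Fhg : F %| (h \Po l) \Po g.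
  by rewrite -comp_polyA linearZ /= comp_polyX.
apply/negPn; rewrite -irreducible_poly_coprime //.
apply/negP => /(coprimep_comp_poly g) /(coprimep_dvdl Fhg).
move=> /(coprimep_dvdr Ffg); rewrite coprimepp => /eqP F1.
by rewrite F1 in F_gt1.
Qed.

(** Over the fraction field: a root theta of F generates a field containing
    g(theta), whose degree is that of f. *)
Lemma leq_size_factor_comp (R : idomainType) (f g F : {poly R}) :
  irreducible_poly f -> F %| f \Po g -> (1 < size F)%N ->
  (size f <= size F)%N.
Proof.
move=> f_irr Ffg F_gt1.
have [e [h [h_size _ fh]]] :=
  irreducible_dvd_annihilator R f g F f_irr Ffg F_gt1.
rewrite -h_size dvdp_leq // -size_poly_gt0 h_size; exact: ltnW.
Qed.

Lemma irreducible_comp_linear (R : idomainType) (f g : {poly R}) :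
  irreducible_poly f -> size g = 2 -> irreducible_poly (f \Po g).
Proof.
move=> f_irr g_size; have fg_size := size_comp_poly2 f g_size.
have fg_neq0 : f \Po g != 0 by rewrite comp_poly2_eq0 ?irredp_neq0.
split=> [|F F1 Ffg]; first by rewrite fg_size f_irr.
rewrite -dvdp_size_eqp // eqn_leq dvdp_leq //= fg_size.
apply: (leq_size_factor_comp R f g) => //.
by rewrite ltn_neqAle eq_sym F1 size_poly_gt0 (dvdpN0 Ffg).
Qed.

(** * Gauss lemma at an irreducible polynomial of K[X] *)

Lemma irreducible_dvdpM (K : fieldType) (p a b : {poly K}) :
  irreducible_poly p -> (p %| a * b) = (p %| a) || (p %| b).
Proof.
move=> p_irr; apply/idP/orP => [|[pa|pb]]; last 2 first.
- exact: dvdp_mulr.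
- exact: dvdp_mull.
have [pa|] := boolP (p %| a); first by left.
rewrite -irreducible_poly_coprime // => p_a.
by rewrite Gauss_dvdpr // => pb; right.
Qed.

Lemma irreducible_dvdpX (K : fieldType) (p a : {poly K}) e :
  irreducible_poly p -> p %| a ^+ e -> p %| a.
Proof.
move=> p_irr; elim: e => [|e IHe]; last first.
  by rewrite exprS irreducible_dvdpM // => /orP[].
by rewrite expr0 dvdp1 => /eqP p1; have := p_irr.1; rewrite p1.
Qed.

(** Replacing the coefficients of F and G by their remainders mod p keeps the
    product divisible by p.  If both reductions were nonzero, p would divide
    the product of their leading coefficients, hence one of these, which is a
    nonzero remainder mod p. *)
Lemma gauss_coefs (K : fieldType) (p : {poly K}) (F G H : {poly {poly K}}) :
  irreducible_poly p -> p *: H = F * G ->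
  (exists F', F = p *: F') \/ (exists G', G = p *: G').
Proof.
move=> p_irr DH; pose red := map_poly (fun a : {poly K} => a %% p).
pose quo := map_poly (fun a : {poly K} => a %/ p).
have redE (P : {poly {poly K}}) : P = red P + p *: quo P.
  apply/polyP => i; rewrite coefD coefZ !coef_map_id0 ?mod0p ?div0p //.
  by rewrite addrC mulrC -divp_eq.
have red_lead (P : {poly {poly K}}) : p %| lead_coef (red P) -> red P = 0.
  move=> p_lead; apply/eqP; rewrite -lead_coef_eq0; apply: contraTT p_lead.
  move=> nz; apply: contra nz; rewrite lead_coefE coef_map_id0 ?mod0p //.
  by rewrite /dvdp modp_id.
have : p %| lead_coef (red F) * lead_coef (red G).
  have DFG : red F * red G = p *: (H - red F * quo G - quo F * G).
    apply/eqP; rewrite eq_sym !scalerBr DH !subr_eq addrAC.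
    by rewrite [p *: (red F * _)]scalerAr -mulrDr -redE scalerAl -mulrDl -redE.
  by rewrite -lead_coefM DFG lead_coefE coefZ dvdp_mulIl.
rewrite irreducible_dvdpM // => /orP[] /red_lead red0; [left|right].
  by exists (quo F); rewrite {1}(redE F) red0 add0r.
by exists (quo G); rewrite {1}(redE G) red0 add0r.
Qed.

(** Each factor p of the scalar c divides F or G by Gauss's lemma and can be
    cancelled there; the degree of c drops until p no longer divides it. *)
Lemma gauss_clear_scalar (K : fieldType) (p c : {poly K})
    (F G H : {poly {poly K}}) :
  irreducible_poly p -> c != 0 -> c *: H = F * G ->
  exists c' d e (F' G' : {poly {poly K}}),
    [/\ ~~ (p %| c'), F = d *: F', G = e *: G' & c' *: H = F' * G'].
Proof.
move=> p_irr; have [n] := ubnP (size c).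
elim: n => // n IHn in c F G *; rewrite ltnS => c_le c_neq0 DH.
have [/dvdpP[b Dc]|pNc] := boolP (p %| c); last first.
  by exists c, 1, 1, F, G; rewrite !scale1r.
have b_neq0 : b != 0 by apply: contraNneq c_neq0 => b0; rewrite Dc b0 mul0r.
have p_neq0 := irredp_neq0 p_irr.
have b_lt : (size b < n)%N.
  have p_gt1 : (1 < size p)%N := p_irr.1.
  apply: leq_trans c_le; rewrite Dc size_mul //.
  by case: (size p) p_gt1 => [|[|k]] // _; rewrite !addnS ltnS leq_addr.
have p_inj : injective ( *:%R p : {poly {poly K}} -> {poly {poly K}}).
  move=> P Q /eqP; rewrite -subr_eq0 -scalerBr -mul_polyC mulf_eq0 polyC_eq0.
  by rewrite (negPf p_neq0) subr_eq0 => /eqP.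
rewrite Dc mulrC -scalerA in DH.
have [[F1 DF]|[G1 DG]] := gauss_coefs K p F G (b *: H) p_irr DH.
  rewrite DF -scalerAl in DH.
  have [c' [d [e [F' [G' [? DF' DG' ?]]]]]] :=
    IHn b F1 G b_lt b_neq0 (p_inj _ _ DH).
  by exists c', (p * d), e, F', G'; split; rewrite // DF DF' scalerA.
rewrite DG -scalerAr in DH.
have [c' [d [e [F' [G' [? DF' DG' ?]]]]]] :=
  IHn b F G1 b_lt b_neq0 (p_inj _ _ DH).
by exists c', d, (p * e), F', G'; split; rewrite // DG DG' scalerA.
Qed.

(** * The criterion *)

(** The leading coefficient of F has a power that, up to a scalar prime to p,
    is a multiple of the leading coefficient of f.  The coefficient of f prime
    to p ensures that removing powers of p from the relation c h = w f takes
    none from f. *)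
Lemma dvdp_lead_coef_factor_comp (K : fieldType) (p : {poly K})
    (f g F : {poly {poly K}}) (i : nat) :
  irreducible_poly p -> irreducible_poly f ->
  p %| lead_coef f -> ~~ (p %| f`_i) ->
  F %| f \Po g -> (1 < size F)%N -> p %| lead_coef F.
Proof.
move=> p_irr f_irr p_lead pNfi Ffg F_gt1.
have [e [h [_ h_lead fh]]] :=
  irreducible_dvd_annihilator _ f g F f_irr Ffg F_gt1.
have [[c w] /= c_neq0 Dh] := Pdiv.Idomain.dvdpP _ _ fh.
have [c' [d [b [w' [f' [pNc Dw Df Dh']]]]]] :=
  gauss_clear_scalar K p c w f h p_irr c_neq0 Dh.
have pNb : ~~ (p %| b).
  by apply: contra pNfi => pb; rewrite Df coefZ dvdp_mulr.
have p_lead' : p %| lead_coef f'.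
  by move: p_lead; rewrite Df lead_coefZ irreducible_dvdpM // (negPf pNb).
apply: (irreducible_dvdpX K p _ e p_irr); rewrite -h_lead.
have: p %| c' * lead_coef h by rewrite -lead_coefZ Dh' lead_coefM dvdp_mull.
by rewrite irreducible_dvdpM // (negPf pNc).
Qed.

(** Two nonconstant factors would each contribute a p to the leading
    coefficient of f(g). *)
Lemma irreducible_comp_simple_lead_factor (K : fieldType) (p : {poly K})
    (f g : {poly {poly K}}) (i : nat) :
  irreducible_poly p -> irreducible_poly f -> (1 < size g)%N ->
  p %| lead_coef f -> ~~ (p %| f`_i) ->
  ~~ (p * p %| lead_coef (f \Po g)) -> irreducible_poly (f \Po g).
Proof.
move=> p_irr f_irr g_gt1 p_lead pNfi ppN.
have fg_neq0 : f \Po g != 0 by rewrite comp_poly_eq0 ?irredp_neq0.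
have fg_gt1 : (1 < size (f \Po g))%N.
  rewrite (polySpred fg_neq0) size_comp_poly ltnS muln_gt0.
  by rewrite -!subn1 !subn_gt0 f_irr.1 g_gt1.
split=> // Q Q1 Qfg.
have [[c W] /= c_neq0 DW] := Pdiv.Idomain.dvdpP _ _ Qfg.
have [c' [d [e [W' [Q' [pNc DW' DQ Dfg]]]]]] :=
  gauss_clear_scalar K p c W Q (f \Po g) p_irr c_neq0 DW.
have c'_neq0 : c' != 0 by apply: contraNneq pNc => ->; rewrite dvdp0.
have: W' * Q' != 0 by rewrite -Dfg -mul_polyC mulf_neq0 ?polyC_eq0.
rewrite mulf_eq0 negb_or => /andP[W'_neq0 Q'_neq0].
have e_neq0 : e != 0.
  apply: contraTneq (dvdpN0 Qfg fg_neq0) => e0.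
  by rewrite DQ e0 scale0r eqxx.
have W'fg : W' %| f \Po g by rewrite -(dvdpZr _ _ c'_neq0) Dfg dvdp_mulIl.
have Q'fg : Q' %| f \Po g by rewrite -(dvdpZr _ _ c'_neq0) Dfg dvdp_mulIr.
have Q'_gt1 : (1 < size Q')%N.
  rewrite ltn_neqAle eq_sym size_poly_gt0 Q'_neq0 andbT.
  by rewrite -(size_scale _ e_neq0) -DQ.
have [W'_le1|W'_gt1] := leqP (size W') 1.
  rewrite -dvdp_size_eqp // -(size_scale (f \Po g) c'_neq0) Dfg size_mul //.
  have -> : size W' = 1%N by apply/eqP; rewrite eqn_leq W'_le1 size_poly_gt0.
  by rewrite add1n DQ size_scale.
case/negP: ppN.
have: p * p %| c' * lead_coef (f \Po g).
  rewrite -lead_coefZ Dfg lead_coefM dvdp_mul //.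
    exact: (dvdp_lead_coef_factor_comp K p f g W' i).
  exact: (dvdp_lead_coef_factor_comp K p f g Q' i).
by rewrite Gauss_dvdpr // coprimepMl irreducible_poly_coprime // pNc.
Qed.

Theorem corollary3 (K : fieldType) (m n : nat) (a b : nat -> {poly K})
    (f g : {poly {poly K}}) (p q : {poly K})
    (m_ge1 : (1 <= m)%N) (n_ge1 : (1 <= n)%N)
    (f_def : f = \sum_(i < m.+1) (a i)%:P * 'X^i)
    (g_def : g = \sum_(j < n.+1) (b j)%:P * 'X^j)
    (nz : a 0%N * a m * b n != 0)
    (f_irr : irreducible_over_KX f)
    (am_def : a m = p * q)
    (p_irr : irreducible_poly p)
    (deg_p : (pdeg p > (n - 1) * pdeg q + m * n * pdeg (b n) + H1 f)%N) :
  irreducible_over_KX (f \Po g).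
Proof.
move: nz; rewrite !mulf_eq0 !negb_or => /andP[/andP[a0_neq0 am_neq0] bn_neq0].
have sumE k (c : nat -> {poly K}) :
    \sum_(i < k) (c i)%:P * 'X^i = \poly_(i < k) c i.
  by rewrite poly_def; apply: eq_bigr => i _; rewrite mul_polyC.
rewrite sumE in f_def; rewrite sumE in g_def.
have f_size : size f = m.+1 by rewrite f_def size_poly_eq.
have g_size : size g = n.+1 by rewrite g_def size_poly_eq.
have f_lead : lead_coef f = p * q.
  by rewrite lead_coefE f_size f_def coef_poly ltnSn.
have g_lead : lead_coef g = b n.
  by rewrite lead_coefE g_size g_def coef_poly ltnSn.
have f0 : f`_0 = a 0%N by rewrite f_def coef_poly.
apply/irreducible_tofrac; move/irreducible_tofrac: f_irr => f_irr.
have pN (c : {poly K}) : c != 0 -> (pdeg c < pdeg p)%N -> ~~ (p %| c).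
  move=> c_neq0; apply: contraL => /dvdp_leq -/(_ c_neq0) p_le.
  by rewrite -leqNgt /pdeg -!subn1 leq_sub2r.
have [n1|n_neq1] := eqVneq n 1%N.
  by apply: irreducible_comp_linear; rewrite // g_size n1.
have n_gt1 : (1 < n)%N by rewrite ltn_neqAle eq_sym n_neq1.
have q_neq0 : q != 0.
  by apply: contraNneq am_neq0 => q0; rewrite am_def q0 mulr0.
have pNa0 : ~~ (p %| f`_0).
  rewrite f0; apply: pN => //; apply: leq_ltn_trans deg_p.
  apply: leq_trans (leq_addl _ _).
  have pdf : (0 < pdeg f)%N by rewrite /pdeg f_size.
  by rewrite -f0 /H1 (leq_bigmax_cond (Ordinal pdf)) //= f0.
have pNq : ~~ (p %| q).
  apply: pN => //; apply: leq_ltn_trans deg_p; rewrite -addnA.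
  by apply: leq_trans (leq_addr _ _); rewrite leq_pmull ?subn_gt0.
have pNb : ~~ (p %| b n).
  apply: pN => //; apply: leq_ltn_trans deg_p; rewrite -addnA addnCA.
  by apply: leq_trans (leq_addr _ _); rewrite leq_pmull ?muln_gt0 ?m_ge1.
apply: (irreducible_comp_simple_lead_factor K p f g 0) => //.
- by rewrite g_size.
- by rewrite f_lead dvdp_mulr.
rewrite lead_coef_comp ?g_size // f_lead g_lead -mulrA.
rewrite dvdp_mul2l ?(irredp_neq0 p_irr) //.
rewrite irreducible_dvdpM // negb_or pNq.
by apply: contra pNb; apply: irreducible_dvdpX.
Qed.
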